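(* Let $n\in\mathbb{N}$ and let $\delta$ be a positive infinitesimal in ${}^*\mathbb{R}$. Then $(\mathcal{G},\tau^\delta)$ is an absolutely convex, Hausdorff vector space which is not absorbent (hence not locally convex), and scalar multiplication $\mathbb{R}\times\mathcal{G}\to\mathcal{G}$ is not continuous. Here absolutely convex means that the subbasic neighborhoods $U^\delta_{\mathfrak r}$ ($\mathfrak r\in\mathcal{N}_\delta$) of $[0]$ are absolutely convex (convex and balanced) sets, and not absorbent means that the neighborhoods of $[0]$ are not all absorbing subsets of $\mathcal{G}$.
   Context: A sufficiently saturated nonstandard extension $X\mapsto{}^*X$ (at least an enlargement) is fixed. $\mathcal{G}=\mathcal{G}_{n,1}$ is the ring (and real vector space) of germs at $0$ of arbitrary functions $f:(\mathbb{R}^n,0)\to(\mathbb{R},0)$ (defined on a neighborhood of $0$, $f(0)=0$). For real $r>0$, $\|f\|_r=\sup\{|f(x)|:|x|\le r\}$, and ${}^*\|f\|_\delta$ is the value at $\delta$ of the transfer of $r\mapsto\|f\|_r$, i.e. the internal supremum of $|{}^*f|$ on $B_\delta=\{\xi\in{}^*\mathbb{R}^n:|\xi|\le\delta\}$. $\mathcal{M}$ is the set of germs at $0$ of functions $m:\mathbb{R}_+\to\mathbb{R}_+$ with $\lim_{t\to0}m(t)=0$ and $m(r)<m(t)$ for all sufficiently small $0<r<t$. $\mathcal{N}_\delta=\{{}^*m(\delta):[m]\in\mathcal{M}\}$ (equivalently, the set of ${}^*\|g\|_\delta$ with $[g]\in\mathcal{G}$, $\|g\|_r\to0$ as $r\to0$,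 and $\|g\|_r<\|g\|_s$ for all sufficiently small $0<r<s$). For $\mathfrak r\in\mathcal{N}_\delta$, $U^\delta_{\mathfrak r}=\{[f]\in\mathcal{G}:{}^*\|f\|_\delta<\mathfrak r\}$. $\tau^\delta$ is the topology on $\mathcal{G}$ generated by the subbase of all translates $U^\delta_{\mathfrak r}+[f]$, $\mathfrak r\in\mathcal{N}_\delta$, $[f]\in\mathcal{G}$. *)

(* Defs.v *)
From HB Require Import structures.
From mathcomp Require Import all_boot all_order all_algebra.
From mathcomp Require Import generic_quotient.
From mathcomp Require Import all_classical all_reals all_analysis.

Set Implicit Arguments.
Unset Strict Implicit.
Unset Printing Implicit Defensive.

Import Order.TTheory GRing.Theory Num.Theory.
Import numFieldNormedType.Exports.

Local Open Scope classical_set_scope.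
Local Open Scope ring_scope.
Local Open Scope quotient_scope.

(** The extension X |-> *X acts on every type X, every function f (giving *f)
    and every set A (giving *A).  The transfer principle is given by its
    inductive clauses: any first-order formula over standard sets and functions
    is built from [_ = _] by substitution of terms, conjunction, negation and
    existential quantification, and the clauses below say that A |-> *A commutes
    with each of these.  Since X ranges over all types, including [set X], this
    covers the bounded formulas of the superstructure approach; internal sets
    are the elements of *(set X). *)
Record nonstandard_extension := NonstandardExtension {
  star : Type -> Type;
  std : forall X : Type, X -> star X;
  starf : forall X Y : Type, (X -> Y) -> star X -> star Y;
  starp : forall X Y : Type, star X -> star Y -> star (X * Y)%type;
  stars : forall X : Type, set X -> set (star X);
  starf_id : forall (X : Type) (x : star X), starf (fun a : X => a) x = x;
  starf_comp : forall (X Y Z : Type) (f : X -> Y) (g : Y -> Z) (x : star X),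
    starf (fun a => g (f a)) x = starf g (starf f x);
  starf_std : forall (X Y : Type) (f : X -> Y) (a : X),
    starf f (std a) = std (f a);
  starp_fst : forall (X Y : Type) (x : star X) (y : star Y),
    starf fst (starp x y) = x;
  starp_snd : forall (X Y : Type) (x : star X) (y : star Y),
    starf snd (starp x y) = y;
  starp_eta : forall (X Y : Type) (z : star (X * Y)%type),
    starp (starf fst z) (starf snd z) = z;
  stars_std : forall (X : Type) (A : set X) (a : X),
    stars A (std a) <-> A a;
  stars_eq : forall (X : Type) (x y : star X),
    stars [set z : X * X | z.1 = z.2] (starp x y) <-> x = y;
  stars_preimage : forall (X Y : Type) (f : X -> Y) (A : set Y),
    stars (f @^-1` A) = starf f @^-1` stars A;
  stars_setI : forall (X : Type) (A B : set X),
    stars (A `&` B) = stars A `&` stars B;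
  stars_setC : forall (X : Type) (A : set X), stars (~` A) = ~` stars A;
  stars_image : forall (X Y : Type) (f : X -> Y) (A : set X),
    stars (f @` A) = starf f @` stars A
}.

Arguments std E {X} : rename.
Arguments starf E {X Y} : rename.
Arguments starp E {X Y} : rename.
Arguments stars E {X} : rename.

Definition enlargement (E : nonstandard_extension) : Prop :=
  forall (X : Type) (F : set (set X)),
    finI F id -> exists x : star E X, forall A, F A -> stars E A x.

Definition starr (E : nonstandard_extension) (X Y : Type) (P : X -> Y -> Prop)
    (x : star E X) (y : star E Y) : Prop :=
  stars E [set z : X * Y | P z.1 z.2] (starp E x y).

Definition positive_infinitesimal (R : realType) (E : nonstandard_extension)
    (d : star E R) : Prop :=
  starr (fun x y : R => x < y) (std E 0) d /\
  forall e : R, 0 < e -> starr (fun x y : R => x < y) d (std E e).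

Section Germs.
Variables (R : realType) (n : nat).

Definition vanishing : {pred 'rV[R]_n -> R} := fun f => f 0 == 0.

Lemma vanishing_submod : submod_closed vanishing.
Proof.
split=> [|a f g]; rewrite !unfold_in ?eqxx// => /eqP f0 /eqP g0.
have -> : (a *: f + g) 0 = a *: f 0 + g 0 by [].
by rewrite f0 g0 scaler0 addr0.
Qed.

HB.instance Definition _ :=
  GRing.isSubmodClosed.Build R ('rV[R]_n -> R) vanishing vanishing_submod.

Record pfun0 := PFun0 { pfun0_val :> 'rV[R]_n -> R;
                        pfun0P : pfun0_val \in vanishing }.

HB.instance Definition _ := [isSub for pfun0_val].
HB.instance Definition _ := [Choice of pfun0 by <:].
HB.instance Definition _ := [SubChoice_isSubLmodule of pfun0 by <:].

Definition germ0 : {pred pfun0} := 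
  fun f => `[< \forall x \near (0 : 'rV[R]_n), f x = 0 >].

Lemma germ0_submod : submod_closed germ0.
Proof.
split=> [|a f g]; rewrite !unfold_in; first by apply/asboolP; near=> x.
move=> /asboolP f0 /asboolP g0; apply/asboolP; near=> x.
have -> : (a *: f + g) x = a *: f x + g x by [].
have -> : f x = 0 by near: x.
have -> : g x = 0 by near: x.
by rewrite scaler0 addr0.
Unshelve. all: by end_near. Qed.

HB.instance Definition _ :=
  GRing.isSubmodClosed.Build R pfun0 germ0 germ0_submod.

(** A germ of functions defined near 0 always has a representative defined on
    the whole space, so total functions suffice. *)
Definition germ := Quotient.quot germ0.

HB.instance Definition _ := GRing.Zmodule.on germ.
HB.instance Definition _ := EqQuotient.on germ.

Definition germ_scale (a : R) : germ -> germ :=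
  lift_op1 germ (fun f => a *: f).

Lemma pi_germ_scale a : {morph \pi_germ : f / a *: f >-> germ_scale a f}.
Proof.
move=> f; unlock germ_scale; apply/eqP; rewrite -Quotient.idealrBE -scalerBr.
by rewrite rpredZ// Quotient.idealrBE reprK.
Qed.

Lemma germ_scaleA a b f : germ_scale a (germ_scale b f) = germ_scale (a * b) f.
Proof. by rewrite -[f]reprK -!pi_germ_scale scalerA. Qed.

Lemma germ_scale1 : left_id 1 germ_scale.
Proof. by move=> f; rewrite -[f]reprK -pi_germ_scale scale1r. Qed.

Lemma germ_scaleDr : right_distributive germ_scale +%R.
Proof.
move=> a f g; rewrite -[f]reprK -[g]reprK.
by rewrite -raddfD -!pi_germ_scale scalerDr raddfD.
Qed.

Lemma germ_scaleDl f : {morph germ_scale^~ f : a b / a + b}.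
Proof. by move=> a b; rewrite -[f]reprK -!pi_germ_scale scalerDl raddfD. Qed.

HB.instance Definition _ := GRing.Zmodule_isLmodule.Build R germ
  germ_scaleA germ_scale1 germ_scaleDr germ_scaleDl.

(** [`|x|] is the sup norm on ['rV[R]_n]; the balls below are Euclidean. *)
Definition enorm (x : 'rV[R]_n) : R := Num.sqrt (\sum_(i < n) x ord0 i ^+ 2).

(** Infinite when f is unbounded on the ball. *)
Definition supnorm (f : 'rV[R]_n -> R) (r : R) : \bar R :=
  ereal_sup [set `|f x|%:E | x in [set x | enorm x <= r]].

End Germs.

(** Functions R_+ -> R_+ are the restrictions to positive reals of total
    functions mapping positive reals to positive reals. *)
Definition gauge (R : realType) (m : R -> R) : Prop :=
  [/\ forall t, 0 < t -> 0 < m t,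
      m t @[t --> 0^'+] --> 0
    & exists2 e, 0 < e & forall r t, 0 < r -> r < t -> t < e -> m r < m t].

(** An alias of [germ R n] depending on [d], carrying the topology attached to
    [d]. *)
Definition germ_tau (R : realType) (n : nat) (E : nonstandard_extension)
    (d : star E R) : Type := germ R n.

Arguments germ_tau {R} n {E} d.

Section GermTopology.
Variables (R : realType) (n : nat) (E : nonstandard_extension) (d : star E R).

Definition gauge_values : set (star E R) :=
  [set starf E m d | m in gauge (R := R)].

Definition germ_ball (r : star E R) : set (germ R n) :=
  [set \pi_(germ R n) f | f in [set f : pfun0 R n |
    starr (fun x y : \bar R => (x < y)%E)
      (starf E (supnorm f) d) (starf E EFin r)]].

HB.instance Definition _ := GRing.Lmodule.on (germ_tau n d).

Definition germ_subbase : set (set (germ_tau n d)) :=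
  [set [set g + f | g in germ_ball r] | r in gauge_values & f in setT].

HB.instance Definition _ :=
  isSubBaseTopological.Build (germ_tau n d) germ_subbase id.

End GermTopology.

Arguments germ_ball {R} n {E} d r.

Section AbsolutelyConvex.
Variable R : realType.

Definition balanced (V : lmodType R) (A : set V) : Prop :=
  forall (a : R) (x : V), `|a| <= 1 -> A x -> A (a *: x).

Definition absolutely_convex (V : lmodType R) (A : set V) : Prop :=
  convex_set A /\ balanced A.

Definition absorbing (V : lmodType R) (A : set V) : Prop :=
  forall x : V, exists2 e : R, 0 < e & forall a : R, `|a| <= e -> A (a *: x).

(** A necessary condition for the topology to be a locally convex vector space
    topology, stated without continuity of the operations. *)
Definition locally_convex_at0 (V : preTopologicalLmodType R) : Prop :=
  forall A : set V, nbhs 0 A ->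
    exists B : set V, [/\ nbhs 0 B, absolutely_convex B, absorbing B & B `<=` A].

End AbsolutelyConvex.

(* Main.v *)
Require Import Defs.
From mathcomp Require Import all_boot all_order all_algebra.
From mathcomp Require Import generic_quotient.
From mathcomp Require Import all_classical all_reals all_analysis.

Set Implicit Arguments.
Unset Strict Implicit.
Unset Printing Implicit Defensive.

Import Order.TTheory GRing.Theory Num.Theory.
Import numFieldNormedType.Exports.

Local Open Scope classical_set_scope.
Local Open Scope ring_scope.

(** The point [d] is only ever seen through the family of standard sets [A]
    with [d] in [*A]. Transfer makes this family a proper filter on [R], and
    [d] being a positive infinitesimal says exactly that it refines [0^'+].
    A relation between internal quantities [*f(d)] and [*g(d)] then means that
    [f t] and [g t] are so related for [t] near this filter, and the
    statement becomes one about suprema of standard functions on small balls.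

    - Balls. If the supremum of [|f|] on the ball of radius [t] is below [m t]
      and that of [|g|] is below [p t], then that of [|f + g|] is below
      [m t + p t], and that of [|a f|] is below [|a| m t] when [a != 0].
      Convexity and balancedness of the balls are special cases
      ([germ_ball_absolutely_convex]).

    - Addition ([germ_tau_add_continuous]). The naive argument, finding a gauge
      [p] with [||k|| + 2 p <= m] at [d] when [||k|| < m] there, breaks down:
      [m(t) - ||k||_t] need not be monotone, and it can lie at [d] below every
      gauge value. But translates of balls are neighbourhoods of each of their
      points, not just of their centres, so one can halve the whole picture:
      the ball of radius [m] around [-k] contains the sum of two copies of the
      ball of radius [m/2] around [-k/2], and the latter contains 0.

    - Hausdorff ([germ_tau_hausdorff]). If [h] is a nonzero germ then [||h||_t]
      is positive for all [t > 0] and nondecreasing in [t], so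
      [t min (||h||_t, 1)] is a gauge, and at [d] it is infinitely small
      compared to [||h||].

    - The negative claims. The germ [u] equal to 1 off the origin has
      [||a u||_t = |a|], so [a u] with [a != 0] real never enters the ball of
      radius [d]: this ball is not absorbing. A neighbourhood base of absorbing
      sets, or continuity of [a |-> a u] at [a = 0], would contradict
      this. *)

(** * Transfer as a filter *)

Section Transfer.
Variable E : nonstandard_extension.

(** When [x] is the point of an ultrapower represented by the identity, this is
    the ultrafilter defining the ultrapower. *)
Definition star_filter (X : Type) (x : star E X) : set_system X :=
  [set A | stars E A x].

Lemma starsT (X : Type) (x : star E X) : stars E setT x.
Proof.
have [//|nTx] := pselect (stars E setT x).
have : stars E set0 x by rewrite -setCT stars_setC.
by rewrite -(setI0 setT) stars_setI => -[].
Qed.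

Lemma star_filter_proper (X : Type) (x : star E X) :
  ProperFilter (star_filter x).
Proof.
apply: Build_ProperFilter => [|]; rewrite /star_filter /=.
  by rewrite -setCT stars_setC; apply; exact: starsT.
split=> [|A B Ax Bx|A B AB Ax] /=; first exact: starsT.
  by rewrite stars_setI.
have : stars E (A `&` B) x by rewrite (setIidl AB).
  by rewrite stars_setI => -[].
Qed.

Lemma starf_pair (X Y Z : Type) (f : X -> Y) (g : X -> Z) (x : star E X) :
  starp E (starf E f x) (starf E g x) = starf E (fun a => (f a, g a)) x.
Proof.
by rewrite -[RHS](starp_eta ) -!(starf_comp ).
Qed.

(** A constant map factors through [unit], whose extension has a single point
    because equality on [unit] is the full relation. *)
Lemma starf_cst (X Y : Type) (c : Y) (x : star E X) :
  starf E (fun=> c) x = std E c.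
Proof.
rewrite (starf_comp  (fun=> tt) (fun=> c)) -(starf_std _ (fun=> c) tt).
congr (starf E _ _); apply/(stars_eq ).
have -> : [set z : unit * unit | z.1 = z.2] = setT.
  by apply/seteqP; split=> // -[[] []].
exact: starsT.
Qed.

(** Only internal points of the form [*f(x)] ever occur below, and this turns
    every relation between two of them into a filter statement. *)
Lemma starrE (X Y Z : Type) (P : Y -> Z -> Prop) (f : X -> Y) (g : X -> Z)
    (x : star E X) :
  starr P (starf E f x) (starf E g x) <->
  \forall t \near star_filter x, P (f t) (g t).
Proof.
rewrite /starr starf_pair -[stars E _ _]/((starf E _ @^-1` stars E _) x).
by rewrite -(stars_preimage ).
Qed.

Lemma star_filter_right (R : realType) (d : star E R) :
  positive_infinitesimal d -> star_filter d --> (0 : R)^'+.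
Proof.
move=> [d0 de] A; have FF := star_filter_proper d.
case=> e /= e0 eA.
rewrite nbhs_filterE.
have F0 : \forall t \near star_filter d, 0 < t.
  apply/(starrE (fun x y : R => x < y) (fun=> 0) (fun t => t) d).
  by rewrite starf_cst starf_id.
have Fe : \forall t \near star_filter d, t < e.
  apply/(starrE (fun x y : R => x < y) (fun t => t) (fun=> e) d).
  by rewrite starf_cst starf_id; exact: de.
near=> t; apply: eA => /=; last by near: t.
have t0 : 0 < t by near: t.
by rewrite sub0r normrN gtr0_norm//; near: t.
Unshelve. all: by end_near. Qed.

End Transfer.

#[local] Existing Instance star_filter_proper.

(** * Euclidean balls and suprema on them *)

Section Balls.
Variables (R : realType) (n : nat).
Implicit Types (f g : 'rV[R]_n -> R) (t s m : R).

(** A strict bound on the supremum leaves room for a real bound [s], also when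
    the supremum is infinite: this is what removes extended reals from the
    estimates. *)
Lemma supnorm_ltP f t m : (supnorm f t < m%:E)%E <->
  exists2 s, s < m & forall x, enorm x <= t -> `|f x| <= s.
Proof.
split=> [|[s sm fs]].
  rewrite ltNge => /negP fm.
  have fle x : enorm x <= t -> (`|f x|%:E <= supnorm f t)%E.
    by move=> xt; apply: ereal_sup_ubound; exists x.
  move: fm fle; case: (supnorm f t) => [s| |] fm fle.
  - exists s; first by rewrite ltNge -lee_fin; exact/negP.
    by move=> x /fle; rewrite lee_fin.
  - by exfalso; apply: fm; rewrite leey.
  (* the supremum is -oo exactly when the ball is empty, so any s < m will do *)
  - by exists (m - 1); [rewrite ltrBlDr ltrDl|move=> x /fle].
apply: (@le_lt_trans _ _ s%:E); last by rewrite lte_fin.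
by apply: ge_ereal_sup => _ [x xt <-]; rewrite lee_fin fs.
Qed.

Lemma enorm0 : enorm (0 : 'rV[R]_n) = 0.
Proof.
by rewrite /enorm big1 ?sqrtr0// => i _; rewrite mxE expr0n.
Qed.

Lemma le_norm_enorm (x : 'rV[R]_n) : `|x| <= enorm x.
Proof.
rewrite [leLHS]/Num.norm /= mx_normrE; apply: bigmax_le => [|[i j] _ /=].
  exact: sqrtr_ge0.
rewrite -sqrtr_sqr (ord1 i) /enorm ler_wsqrtr// (bigD1 j)//= lerDl.
by apply: sumr_ge0 => k _; exact: sqr_ge0.
Qed.

Lemma enorm_continuous : continuous (@enorm R n).
Proof.
move=> x; apply: continuous_comp; last exact: sqrt_continuous.
move: x; apply: continuous_big => [|i _ x]; first exact: add_continuous.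
apply: (@continuous_comp _ _ _ (fun y : 'rV[R]_n => y ord0 i)
  (fun r => r ^+ 2)).
  exact: coord_continuous.
exact: exprn_continuous.
Qed.

(** The topology of ['rV[R]_n] comes from the sup norm, whereas the balls
    in [supnorm] are Euclidean. *)
Lemma near_enormP (P : 'rV[R]_n -> Prop) :
  (\forall x \near (0 : 'rV[R]_n), P x) <->
  exists2 e : R, 0 < e & forall x, enorm x <= e -> P x.
Proof.
split=> [/nbhs_norm0P[e /= e0 eP]|[e e0 eP]].
  exists (e / 2); first by rewrite divr_gt0.
  move=> x xe; apply: eP => /=.
  rewrite (le_lt_trans (le_norm_enorm x))// (le_lt_trans xe)//.
  by rewrite ltr_pdivrMr// ltr_pMr// ltr1n.
have : enorm x @[x --> (0 : 'rV[R]_n)] --> (0 : R).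
  by rewrite -enorm0; exact: enorm_continuous.
move=> /cvgr0_norm_le/(_ _ e0); apply: filterS => x.
by rewrite ger0_norm ?sqrtr_ge0//; exact: eP.
Qed.

End Balls.

(** * Gauges *)

Section Gauges.
Variable R : realType.

Lemma gauge_id : gauge (fun t : R => t).
Proof.
split=> //; last by exists 1.
by apply: cvg_at_right_filter; exact: cvg_id.
Qed.

Lemma gaugeZ (c : R) (m : R -> R) : 0 < c ->
  gauge m -> gauge (fun t => c * m t).
Proof.
move=> c0 [m0 mcvg [e e0 mono]]; split.
- by move=> t t0; rewrite mulr_gt0// m0.
- rewrite -[X in _ --> X](mulr0 c).
  by apply: (@cvgM _ _ _ _ (cst c) m) => //; exact: cvg_cst.
- by exists e => // r t r0 rt te; rewrite ltr_pM2l// mono.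
Qed.

End Gauges.

(** * Balls of germs *)

Section GermBalls.
Local Open Scope quotient_scope.
Variables (R : realType) (n : nat) (E : nonstandard_extension) (d : star E R).
Hypothesis hd : positive_infinitesimal d.

Let F := star_filter d.

Lemma near_star_gt0 : \forall t \near F, 0 < t.
Proof. by apply: (star_filter_right hd); exact: nbhs_right_gt. Qed.

Lemma near_star_lt (e : R) : 0 < e -> \forall t \near F, t < e.
Proof. by move=> e0; apply: (star_filter_right hd); exact: nbhs_right_lt. Qed.

Lemma germ_eqP (f g : pfun0 R n) :
  \pi_(germ R n) f = \pi_(germ R n) g <->
  exists2 e : R, 0 < e & forall x, enorm x <= e -> f x = g x.
Proof.
have -> : \pi_(germ R n) f = \pi_(germ R n) g <-> f - g \in @germ0 R n.
  by rewrite (Quotient.idealrBE (@germ0 R n)); split=> /eqP.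
rewrite unfold_in asboolE near_enormP.
split=> -[e e0 fg]; exists e => // x /fg /eqP.
  by rewrite subr_eq0 => /eqP.
by rewrite -subr_eq0 => /eqP.
Qed.

(** The definition of [germ_ball] asks for one good representative; here any
    representative serves, since two of them agree on some ball of real
    radius, which contains the ball of radius [d]. *)
Lemma germ_ballP (m : R -> R) (f : pfun0 R n) :
  germ_ball n d (starf E m d) (\pi_(germ R n) f) <->
  \forall t \near F,
    exists2 s, s < m t & forall x, enorm x <= t -> `|f x| <= s.
Proof.
have ballE (g : pfun0 R n) :
    starr (fun x y : \bar R => (x < y)%E)
      (starf E (supnorm g) d) (starf E EFin (starf E m d)) <->
    \forall t \near F,
      exists2 s, s < m t & forall x, enorm x <= t -> `|g x| <= s.
  rewrite -starf_comp starrE.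
  by split; apply: filterS => t /supnorm_ltP.
split=> [[g /= /ballE gm /germ_eqP[e e0 gf]]|/ballE fm]; last by exists f.
have te := near_star_lt e0.
near=> t.
have [s sm gs] : exists2 s, s < m t & forall x, enorm x <= t -> `|g x| <= s.
  by near: t.
exists s => // x xt; rewrite -gf ?gs// (le_trans xt)//.
by apply: ltW; near: t.
Unshelve. all: by end_near. Qed.

Lemma germ_ballD (m p : R -> R) (f g : germ R n) :
  germ_ball n d (starf E m d) f -> germ_ball n d (starf E p d) g ->
  germ_ball n d (starf E (m \+ p) d) (f + g).
Proof.
rewrite -[f]reprK -[g]reprK -raddfD !germ_ballP; apply: filterS2.
move=> t [r rm fr] [s sp gs]; exists (r + s); first exact: ltrD.
by move=> x xt; rewrite (le_trans (ler_normD _ _))// lerD ?fr ?gs.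
Qed.

Lemma germ_ballZ (m : R -> R) (a : R) (f : germ R n) : a != 0 ->
  germ_ball n d (starf E m d) f ->
  germ_ball n d (starf E (fun t => `|a| * m t) d) (a *: f).
Proof.
move=> a0; rewrite -[f]reprK -[_ *: _]pi_germ_scale !germ_ballP.
apply: filterS => t [s sm fs]; exists (`|a| * s).
  by rewrite ltr_pM2l// normr_gt0.
by move=> x xt; rewrite [_ x]/(a * _) normrM ler_wpM2l// fs.
Qed.

Lemma germ_ball_le (m p : R -> R) : (\forall t \near F, m t <= p t) ->
  germ_ball n d (starf E m d) `<=` germ_ball n d (starf E p d).
Proof.
move=> mp f; rewrite -[f]reprK !germ_ballP; apply: filterS2 mp => t mp.
by case=> s sm fs; exists s => //; exact: lt_le_trans mp.
Qed.

Lemma germ_ball0 (m : R -> R) : gauge m ->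
  germ_ball n d (starf E m d) 0.
Proof.
move=> [m0 _ _]; rewrite -[0](raddf0 (\pi_(germ R n))) germ_ballP.
apply: filterS near_star_gt0 => t t0; exists 0; first exact: m0.
by move=> x _; rewrite normr0.
Qed.

Lemma germ_ball_absolutely_convex (m : R -> R) : gauge m ->
  absolutely_convex (germ_ball n d (starf E m d) : set (germ R n)).
Proof.
move=> gm; have [m0 _ _] := gm; split.
  apply/convex_setW => f g fm gm' k k0 k1; rewrite !inE in fm gm' *.
  have k'0 : 0 < 1 - k%:num by rewrite subr_gt0.
  have := germ_ballD (germ_ballZ (lt0r_neq0 k0) fm)
    (germ_ballZ (lt0r_neq0 k'0) gm').
  apply: germ_ball_le; apply: nearW => t /=.
  by rewrite !gtr0_norm// -mulrDl addrC subrK mul1r.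
move=> a f a1 fm; have [->|a0] := eqVneq a 0.
  by rewrite scale0r; exact: germ_ball0.
apply: germ_ball_le (germ_ballZ a0 fm).
by apply: filterS near_star_gt0 => t t0; rewrite ler_piMl// ltW// m0.
Qed.

Definition unit_step : 'rV[R]_n -> R := fun x => (x != 0)%:R.

Lemma unit_step_vanishing : unit_step \in @vanishing R n.
Proof. by rewrite unfold_in /unit_step eqxx. Qed.

(** No nonzero real multiple of [unit_step] is infinitesimal off the origin. *)
Lemma unit_step_escapes (a : R) : (0 < n)%N -> a != 0 ->
  ~ germ_ball n d (starf E (fun t => t) d)
      (a *: \pi_(germ R n) (PFun0 unit_step_vanishing)).
Proof.
move=> n0 a0; rewrite -[_ *: _]pi_germ_scale germ_ballP => ball_a.
apply: (@filter_not_empty _ F).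
have ta : \forall t \near F, t < `|a| by apply: near_star_lt; rewrite normr_gt0.
apply: filterS3 near_star_gt0 ta ball_a => t t0 ta [s st as_].
pose x : 'rV[R]_n := t *: delta_mx ord0 (Ordinal n0).
have xE j : x ord0 j = if j == Ordinal n0 then t else 0.
  by rewrite !mxE eqxx; case: eqP => _; rewrite ?mulr1 ?mulr0.
have xt : enorm x = t.
  rewrite /enorm (bigD1 (Ordinal n0))//= big1 => [|j /negPf jn].
    by rewrite xE eqxx addr0 sqrtr_sqr gtr0_norm.
  by rewrite xE jn expr0n.
have x0 : x != 0.
  by apply/eqP => x0; move: t0; rewrite -xt x0 enorm0 ltxx.
have := as_ x; rewrite xt lexx => /(_ isT).
have -> : (a *: PFun0 unit_step_vanishing) x = a.
  by rewrite -[LHS]/(a * unit_step x) /unit_step x0 mulr1.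
move=> as'.
by have := lt_trans (le_lt_trans as' st) ta; rewrite ltxx.
Qed.

(** The supremum [||f||_t] has the right monotonicity to be a gauge, except
    that it may be infinite, constant on an interval, or bounded away from 0.
    Truncating it at 1 and multiplying by [t] cures all three at once and makes
    it smaller than [||f||_t] by a factor [t]. *)
Lemma gauge_below_supnorm (f : pfun0 R n) : \pi_(germ R n) f != 0 ->
  exists2 m : R -> R, gauge m &
    ~ germ_ball n d (starf E (m \+ m) d) (\pi_(germ R n) f).
Proof.
move=> f_neq0.
pose N (t : R) : R := fine (mine (supnorm f t) 1)%E.
have NE t : 0 < t -> (N t)%:E = mine (supnorm f t) 1%E /\ 0 < N t.
  move=> t0.
  have f0 : (0 < supnorm f t)%E.
    rewrite ltNge; apply: contra f_neq0 => /ereal_supP fle.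
    rewrite -(raddf0 (\pi_(germ R n))); apply/eqP/germ_eqP; exists t => // x xt.
    apply/eqP; rewrite -normr_le0 -lee_fin; apply: fle.
    by exists x.
  rewrite /N; case: (supnorm f t) f0 => [s| |]//.
  rewrite lte_fin => s0; rewrite -EFin_min /=; split => //.
  by rewrite lt_min s0 ltr01.
have N_gt0 t : 0 < t -> 0 < N t by move=> /NE[].
have N_le1 t : 0 < t -> N t <= 1.
  by move=> /NE[NE' _]; rewrite -lee_fin NE' ge_min lexx orbT.
have N_mono r t : 0 < r -> r < t -> N r <= N t.
  move=> r0 rt; rewrite -lee_fin (NE _ r0).1 (NE _ (lt_trans r0 rt)).1.
  rewrite le_min !ge_min lexx orbT andbT; apply/orP; left.
  apply: ereal_sup_le => _ [x xr <-]; exists x => //=.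
  exact: le_trans xr (ltW rt).
exists (fun t => t * N t).
  split.
  - by move=> t t0; rewrite mulr_gt0// N_gt0.
  - have [_ id0 _] := gauge_id R.
    apply: (squeeze_cvgr _ (cvg_cst 0) id0).
    near=> t; have t0 : 0 < t by near: t; exact: nbhs_right_gt.
    rewrite mulr_ge0 ?(ltW t0) ?(ltW (N_gt0 _ t0))//=.
    by rewrite ler_piMr ?(ltW t0) ?N_le1.
  - exists 1 => // r t r0 rt _; have t0 := lt_trans r0 rt.
    rewrite (@lt_le_trans _ _ (t * N r))//; first by rewrite ltr_pM2r// N_gt0.
    by rewrite ler_pM2l// N_mono.
rewrite germ_ballP => ball_f; apply: (@filter_not_empty _ F).
(* 2 t N(t) <= N(t) <= supnorm f t as soon as t < 1/2 *)
have t2 := @near_star_lt 2^-1 ltac:(by rewrite invr_gt0).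
apply: filterS3 near_star_gt0 t2 ball_f => t t0 t2 /supnorm_ltP.
have [NE' N0] := NE _ t0.
have fN : (supnorm f t < (N t)%:E)%E -> False.
  by rewrite NE' lt_min ltxx.
move=> ft; apply: fN; apply: (lt_le_trans ft); rewrite lee_fin /=.
rewrite -mulr2n -mulr_natl mulrA ler_piMl ?(ltW N0)//.
by rewrite mulrC -ler_pdivlMr// mul1r ltW.
Unshelve. all: by end_near. Qed.

End GermBalls.

(** * The topology on germs *)

Section GermTopology.
Variables (R : realType) (n : nat) (E : nonstandard_extension) (d : star E R).
Hypothesis hd : positive_infinitesimal d.

Lemma germ_translateP (m : R -> R) (f g : germ_tau n d) :
  [set h + f | h in germ_ball n d (starf E m d)] g <->
  germ_ball n d (starf E m d) (g - f).
Proof.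
split=> [[h hm <-]|gm]; first by rewrite addrK.
by exists (g - f); rewrite ?subrK.
Qed.

Lemma open_germ_translate (m : R -> R) (f : germ_tau n d) : gauge m ->
  open ([set h + f | h in germ_ball n d (starf E m d)] : set (germ_tau n d)).
Proof.
move=> gm; set B := (X in open X).
exists [set B]; last by rewrite bigcup_set1.
move=> _ ->; apply: (@finI_from1 _ _ (@germ_subbase R n E d) id B).
by exists (starf E m d); [exists m|exists f].
Qed.

Lemma nbhs_germ_translate (m : R -> R) (f : germ_tau n d) : gauge m ->
  nbhs f [set h + f | h in germ_ball n d (starf E m d)].
Proof.
move=> gm; apply: open_nbhs_nbhs; split; first exact: open_germ_translate.
by exists 0; [exact: germ_ball0|rewrite add0r].
Qed.

(** Convergence may be tested on the subbase, whose members around [f] are the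
    balls with arbitrary centre [h] that contain [f]. *)
Lemma germ_tau_cvg (T : Type) (F : set_system T) (u : T -> germ_tau n d)
    (f : germ_tau n d) : Filter F ->
  (forall (m : R -> R) (h : germ_tau n d), gauge m ->
    germ_ball n d (starf E m d) (f - h) ->
    \forall x \near F, germ_ball n d (starf E m d) (u x - h)) ->
  u x @[x --> F] --> f.
Proof.
move=> FF uf A; rewrite nbhsE => - [B [[D sD <-] [C DC Cf]] sUA].
apply: filterS sUA _; apply: (@filterS _ _ _ (u @^-1` C)) => [x Cx|].
  by exists C.
have /sD[G sG GC] := DC.
rewrite -GC.
apply: (filter_bigI (f := fun S : set (germ_tau n d) => u @^-1` S)) => S SG.
  have : S f by move: Cf; rewrite -GC; exact.
  have := sG _ SG; rewrite inE => -[_ [m gm <-] [h _ <-]] /germ_translateP fh.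
  by apply: filterS (uf _ _ gm fh) => x /germ_translateP.
Qed.

(** A neighbourhood [h + U_m] of [f + g] contains the sum of the neighbourhoods
    [f - k/2 + U_(m/2)] of [f] and [g - k/2 + U_(m/2)] of [g], where
    [k = f + g - h]. *)
Lemma germ_tau_add_continuous :
  continuous (fun z : germ_tau n d * germ_tau n d => z.1 + z.2).
Proof.
move=> [f g] /=; apply: germ_tau_cvg => m h gm; set k := f + g - h => km.
have c0 : (0 : R) < 2^-1 by rewrite invr_gt0.
have gm2 := gaugeZ c0 gm.
have k2 : germ_ball n d (starf E (fun t => 2^-1 * m t) d) (2^-1 *: k).
  by have := germ_ballZ hd (lt0r_neq0 c0) km; rewrite (gtr0_norm c0).
pose U (p : germ_tau n d) : set (germ_tau n d) :=
  [set q + (p - 2^-1 *: k)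
    | q in germ_ball n d (starf E (fun t => 2^-1 * m t) d)].
have nearU p : nbhs p (U p).
  apply: open_nbhs_nbhs; split; first exact: open_germ_translate.
  by exists (2^-1 *: k); rewrite // addrC subrK.
exists (U f, U g); first by split; exact: nearU.
move=> [a b] /= [/germ_translateP am /germ_translateP bm].
have half2 : 2^-1 + 2^-1 = 1 :> R by rewrite [RHS]splitr div1r.
have kk : k = 2^-1 *: k + 2^-1 *: k by rewrite -scalerDl half2 scale1r.
have -> : a + b - h = (a - (f - 2^-1 *: k)) + (b - (g - 2^-1 *: k)).
  rewrite addrACA -opprD [(f - _) + _]addrACA -opprD -kk /k.
  by rewrite [- (f + g - h)]opprB addrCA subrr addr0.
have := germ_ballD hd am bm; apply: germ_ball_le => //.
apply: nearW => t /=.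
by rewrite -mulrDl half2 mul1r.
Qed.

Lemma germ_tau_hausdorff : hausdorff_space (germ_tau n d).
Proof.
move=> f g fg; apply: contrapT => /eqP; rewrite eq_sym -subr_eq0.
rewrite -[g - f]reprK => /(gauge_below_supnorm hd)[m gm]; apply.
rewrite reprK.
have [p [/germ_translateP pf /germ_translateP pg]] :=
  fg _ _ (nbhs_germ_translate f gm) (nbhs_germ_translate g gm).
have -> : g - f = (p - f) + - (p - g) by rewrite opprB [RHS]addrC addrA subrK.
apply: germ_ballD => //.
have := germ_ballZ hd (_ : -1 != 0) pg; rewrite oppr_eq0 oner_eq0 => /(_ isT).
rewrite scaleN1r; apply: germ_ball_le => //; apply: nearW => t.
by rewrite normrN1 mul1r.
Qed.

Lemma germ_tau_not_absorbing : (0 < n)%N ->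
  exists A : set (germ_tau n d), exists f : germ_tau n d, nbhs 0 A /\
    forall a : R, a != 0 -> ~ A (a *: f).
Proof.
move=> n0; exists (germ_ball n d (starf E (fun t => t) d)).
exists (\pi_(germ R n)%qT (PFun0 (unit_step_vanishing R n))); split.
  apply: filterS (nbhs_germ_translate 0 (gauge_id R)) => _ [f fm <-].
  by rewrite addr0.
by move=> a a0; exact: unit_step_escapes.
Qed.

End GermTopology.

Theorem proposition3p2 (R : realType) (E : nonstandard_extension)
    (hE : enlargement E) (n : nat) (hn : (0 < n)%N) (d : star E R)
    (hd : positive_infinitesimal d) :
  (* absolutely convex *)
  (forall r : star E R, gauge_values d r ->
     absolutely_convex (germ_ball n d r : set (germ_tau n d))) /\
  (* Hausdorff *)
  hausdorff_space (germ_tau n d) /\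
  (* addition is continuous *)
  continuous (fun z : germ_tau n d * germ_tau n d => z.1 + z.2) /\
  (* not absorbent *)
  ~ (forall A : set (germ_tau n d), nbhs 0 A -> absorbing A) /\
  (* not locally convex *)
  ~ locally_convex_at0 (germ_tau n d) /\
  (* scalar multiplication is not continuous *)
  ~ continuous (fun z : R^o * germ_tau n d => z.1 *: z.2).
Proof.
have [A [f [A0 Af]]] := germ_tau_not_absorbing hd hn.
have nabs : ~ absorbing A.
  move=> /(_ f)[e e0 /(_ e)]; rewrite gtr0_norm// lexx => /(_ isT).
  exact/Af/lt0r_neq0.
split; first by move=> _ [m gm <-]; exact: germ_ball_absolutely_convex.
split; first exact: germ_tau_hausdorff.
split; first exact: germ_tau_add_continuous.
split; first by move=> /(_ A A0).
split.
  move=> /(_ A A0)[B [_ _ Babs BA]]; apply: nabs => g.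
  by have [e e0 eB] := Babs g; exists e => // a ae; exact/BA/eB.
move=> /(_ (0 : R^o, f)) /=; rewrite /continuous_at /= scale0r => /(_ A A0).
case=> -[U V] /= [U0 Vf] UVA.
have : \forall a \near (0 : R)^', U a by exact: nbhs_dnbhs U0.
have : \forall a \near (0 : R)^', a != 0 by exact: nbhs_dnbhs_neq.
move=> ane aU; have [a [/Af a0 Ua]] := filter_ex (filterI ane aU).
by apply: a0; apply: (UVA (a, f)); split=> //=; exact: nbhs_singleton Vf.
Qed.
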